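(* Let $A,B,H,K$ be logically independent events. Given a coherent assessment $(x,y)$ on $\{A|H,B|K\}$, the extension $\mu=\mathbb P[(B|K)|(A|H)]$ to the iterated conditional $(B|K)|(A|H)$ is coherent if and only if $\mu\in[\mu',\mu'']$, where $$\mu'=\begin{cases}\max\{0,\frac{x+y-1}{x}\},& x>0,\\ 0,& x=0,\end{cases}\qquad \mu''=\begin{cases}\min\{1,\frac{y}{x}\},& x>0,\\ 1,& x=0.\end{cases}$$
   Context: Events are elements of a Boolean algebra with sure event $\Omega$ and impossible event $\emptyset$; $\overline{E}$ is negation, $EF$ is conjunction, and an event is identified with its $0/1$ indicator. Events $E_1,\dots,E_n$ are logically independent if all $2^n$ conjunctions of the $E_i$ or their negations are $\neq\emptyset$. The constituents generated by events are the nonimpossible such conjunctions. Given real values $x,y,z,\mu$: the conditional event $A|H$ is (numerically) the quantity $AH+x\overline H$, and $B|K$ is $BK+y\overline K$. The conjunction is the conditional random quantity $(A|H)\wedge(B|K)=\min\{AH+x\overline H,\,BK+y\overline K\}\,|\,(H\vee K)$, i.e. it equals that minimum if $H\vee K$ is true and equals its prevision $z$ if $\overline H\,\overline K$ is true. The iterated conditional is $(B|K)|(A|H)=(A|H)\wedge(B|K)+\mu\cdot(\overline A|H)$, where $\mu$ is its prevision and $\overline A|H=1-A|H=\overline AH+(1-x)\overline H$. Coherence (betting scheme). To the four objects $A|H$, $B|K$, $(A|H)\wedge(B|K)$, $(B|K)|(A|H)$ associate the gains $G_1=H(A-x)$, $G_2=K(B-y)$, $G_3=(A|H)\wedge(B|K)-z$,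 $G_4=(B|K)|(A|H)-\mu=(A|H)\wedge(B|K)-\mu\,(A|H)$, and the events on which the respective bets are not called off: $L_1=H$, $L_2=K$, $L_3=H\vee K$, and $L_4=$ the event that the quantity $A|H$ is nonzero, i.e. $L_4=AH$ if $x=0$ (in this case $(B|K)|(A|H)=(BK+y\overline K)|AH$) and $L_4=AH\vee\overline H$ if $x\neq0$. The assessment $(x,y,z,\mu)$ is coherent if for every nonempty $S\subseteq\{1,2,3,4\}$ and all real $s_i$ ($i\in S$), the set $D$ of values taken by $\sum_{i\in S}s_iG_i$ on the constituents (generated by $A,B,H,K$) contained in $\bigvee_{i\in S}L_i$ satisfies $\min D\le 0\le\max D$. The assessment $(x,y)$ on $\{A|H,B|K\}$ is coherent if this holds for all nonempty $S\subseteq\{1,2\}$. Since the iterated conditional involves the conjunction, ''the extension $\mu$ of $(x,y)$ is coherent'' means that there is a real $z$ such that $(x,y,z,\mu)$ is coherent on the four-element family. *)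

(* Defs.v *)
From HB Require Import structures.
From mathcomp Require Import all_boot all_order all_algebra.
From mathcomp Require Import reals.

Set Implicit Arguments.
Unset Strict Implicit.
Unset Printing Implicit Defensive.

Import Order.TTheory GRing.Theory Num.Theory.
Local Open Scope ring_scope.

Section Events.
Context {d : Order.disp_t} {T : ctbDistrLatticeType d}.

(* The conjunction of the E_i (where e i) or their negations (elsewhere). *)
Definition signed_conj n (E : n.-tuple T) (e : {ffun 'I_n -> bool}) : T :=
  (\meet_(i < n) (if e i then tnth E i else ~` tnth E i))%O.

Definition logically_independent n (E : n.-tuple T) : Prop :=
  forall e : {ffun 'I_n -> bool}, signed_conj E e != \bot%O.

Definition constituents n (E : n.-tuple T) : seq T :=
  [seq signed_conj E e | e <- enum {ffun 'I_n -> bool} &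
                         signed_conj E e != \bot%O].

End Events.

Section RandomQuantities.
Context {d : Order.disp_t} {T : ctbDistrLatticeType d} {R : realType}.

(* A random quantity is given by its values on constituents.  An event E
   generated by the basic events is true on a constituent c when c <= E, and
   false (c <= ~` E) otherwise. *)
Definition ind (E : T) (c : T) : R := (c <= E)%O%:R.

Definition cond (A H : T) (x : R) (c : T) : R :=
  ind (A `&` H)%O c + x * ind (~` H)%O c.

Definition conj_cond (A H B K : T) (x y z : R) (c : T) : R :=
  if (c <= H `|` K)%O then Num.min (cond A H x c) (cond B K y c) else z.

Definition iter_cond (A H B K : T) (x y z mu : R) (c : T) : R :=
  conj_cond A H B K x y z c + mu * cond (~` A)%O H (1 - x) c.

(* A bet: its gain, and the event [active] on which it is not called off. *)
Record bet := Bet { gain : T -> R; active : T }.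

Definition bet_cond (A H : T) (x : R) : bet :=
  Bet (fun c => ind H c * (ind A c - x)) H.

Definition bet_conj (A H B K : T) (x y z : R) : bet :=
  Bet (fun c => conj_cond A H B K x y z c - z) (H `|` K)%O.

(* The bet is active exactly when the quantity A|H, with values in {1, 0, x},
   is nonzero. *)
Definition bet_iter (A H B K : T) (x y z mu : R) : bet :=
  Bet (fun c => iter_cond A H B K x y z mu c - mu)
      (if x == 0 then A `&` H else (A `&` H) `|` ~` H)%O.

(* The set D of values of the combined gain with stakes s on the constituents
   (listed in cs) that are contained in the disjunction of the active events. *)
Definition gain_values (cs : seq T) m (F : m.-tuple bet) (S : {set 'I_m})
    (s : 'I_m -> R) : seq R :=
  [seq \sum_(i in S) s i * gain (tnth F i) c
     | c <- cs & (c <= \join_(i in S) active (tnth F i))%O].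

(* Minimum and maximum of a nonempty list; both are 0 on the empty list. *)
Definition seq_min (D : seq R) : R := \big[Num.min/head 0 D]_(v <- D) v.
Definition seq_max (D : seq R) : R := \big[Num.max/head 0 D]_(v <- D) v.

Definition coherent (cs : seq T) m (F : m.-tuple bet) : Prop :=
  forall S : {set 'I_m}, S != set0 -> forall s : 'I_m -> R,
    seq_min (gain_values cs F S s) <= 0 <= seq_max (gain_values cs F S s).

Definition coherent_xy (A B H K : T) (x y : R) : Prop :=
  coherent (constituents [tuple A; B; H; K])
           [tuple bet_cond A H x; bet_cond B K y].

Definition coherent_xyzmu (A B H K : T) (x y z mu : R) : Prop :=
  coherent (constituents [tuple A; B; H; K])
           [tuple bet_cond A H x; bet_cond B K y;
                  bet_conj A H B K x y z; bet_iter A H B K x y z mu].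

Definition coherent_extension (A B H K : T) (x y mu : R) : Prop :=
  exists z : R, coherent_xyzmu A B H K x y z mu.

End RandomQuantities.

(* Coherence of (x, y) forces 0 <= x, so the else branches mean x = 0. *)
Definition mu_low {R : realType} (x y : R) : R :=
  if 0 < x then Num.max 0 ((x + y - 1) / x) else 0.
Definition mu_up {R : realType} (x y : R) : R :=
  if 0 < x then Num.min 1 (y / x) else 1.

(* Main.v *)
(* The four gains satisfy G_4 = G_3 - mu G_1 + (z - mu x), so coherence forces
   z = mu x; betting against
   max(0, A|H + B|K - 1) <= (A|H) /\ (B|K) <= min(A|H, B|K) bounds z, which for
   x > 0 gives the interval for mu.  For x = 0 the bet on the iterated
   conditional alone gives 0 <= mu <= 1.
   Conversely take z = mu x.  The masses z, x - z, y - z, 1 - x - y + z on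
   constituents of ABHK, A~BHK, ~ABHK, ~A~BHK give all four gains mean zero, and
   HK lies in L_1, L_2 and L_3; hence only S = {4} remains, where the masses mu
   and 1 - mu on ABHK and A~BHK, inside L_4, do the same. *)

Require Import Defs.
From HB Require Import structures.
From mathcomp Require Import all_boot all_order all_algebra.
From mathcomp Require Import reals.
From mathcomp Require Import ring lra.

Set Implicit Arguments.
Unset Strict Implicit.
Unset Printing Implicit Defensive.

Import Order.Theory GRing.Theory Num.Theory.
Local Open Scope ring_scope.

(** * Extrema of finite lists of values *)

Section SeqExtrema.
Context {R : realType}.
Implicit Types (D : seq R) (m v : R).

Lemma seq_min_le D v : v \in D -> seq_min D <= v.
Proof. by move=> vD; rewrite /seq_min; exact: (@ge_bigmin_seq _ _ _ _ _ v xpredT id vD). Qed.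

Lemma seq_max_ge D v : v \in D -> v <= seq_max D.
Proof. by move=> vD; rewrite /seq_max; exact: (@le_bigmax_seq _ _ _ _ _ v xpredT id vD). Qed.

(** Membership of [v] excludes the empty list, whose minimum is 0 by convention. *)
Lemma le_seq_min D m v :
  v \in D -> (forall u, u \in D -> m <= u) -> m <= seq_min D.
Proof.
case: D => // w D _ lbD; rewrite /seq_min /= big_seq.
elim/big_ind: _ => [|a b ma mb|//]; first by rewrite lbD ?mem_head.
by rewrite le_min ma mb.
Qed.

End SeqExtrema.

(** * Criteria for violating and for establishing coherence *)

Section Coherence.
Context {d : Order.disp_t} {T : ctbDistrLatticeType d} {R : realType}.
Variables (cs : seq T) (m : nat) (F : m.-tuple (@bet d T R)).

Lemma gain_values_mem (S : {set 'I_m}) (s : 'I_m -> R) (c : T) :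
  c \in cs -> (c <= \join_(i in S) active (tnth F i))%O ->
  \sum_(i in S) s i * gain (tnth F i) c \in gain_values cs F S s.
Proof. by move=> cs_c act_c; apply: map_f; rewrite mem_filter act_c. Qed.

(** A positive [lb] would make the combined bet a sure win. The constituent [c0] ensures that the
    list of gains is nonempty. *)
Lemma coherent_gain_lb (S : {set 'I_m}) (s : 'I_m -> R) (c0 : T) (lb : R) :
  coherent cs F -> S != set0 ->
  c0 \in cs -> (c0 <= \join_(i in S) active (tnth F i))%O ->
  (forall c, c \in cs -> (c <= \join_(i in S) active (tnth F i))%O ->
     lb <= \sum_(i in S) s i * gain (tnth F i) c) ->
  lb <= 0.
Proof.
move=> cohF S0 cs0 act0 lbP; have /andP[min_le0 _] := cohF S S0 s.
apply: le_trans min_le0; apply: (le_seq_min (gain_values_mem s cs0 act0)) => u.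
by case/mapP=> c; rewrite mem_filter => /andP[? ?] ->; apply: lbP.
Qed.

(** If a probability on constituents inside the active events gives each gain mean zero, it gives
    every combination of them mean zero, and a mean lies between minimum and maximum. *)
Lemma coherent_of_null_mean :
  (forall S : {set 'I_m}, S != set0 ->
     exists (I : finType) (p : I -> R) (c : I -> T),
     [/\ forall i, 0 <= p i, \sum_i p i = 1,
         forall i, c i \in cs /\ (c i <= \join_(j in S) active (tnth F j))%O
       & forall j, j \in S -> \sum_i p i * gain (tnth F j) (c i) = 0]) ->
  coherent cs F.
Proof.
move=> meanF S S0 s; have [I [p [c [p0 p1 cP mean0]]]] := meanF S S0.
pose v i := \sum_(j in S) s j * gain (tnth F j) (c i).
have vD i : v i \in gain_values cs F S s.
  by have [? ?] := cP i; apply: gain_values_mem.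
have v0 : \sum_i p i * v i = 0.
  under eq_bigr do rewrite mulr_sumr.
  rewrite exchange_big /= big1 // => j Sj.
  under eq_bigr do rewrite mulrCA.
  by rewrite -mulr_sumr mean0 ?mulr0.
(* Constants are written as means, so that both inequalities can be compared term by term. *)
have scale r : r = \sum_i p i * r by rewrite -mulr_suml p1 mul1r.
by rewrite -v0 [seq_min _]scale [seq_max _]scale; apply/andP; split;
   apply: ler_sum => i _; rewrite ler_wpM2l ?seq_min_le ?seq_max_ge.
Qed.

End Coherence.

(** * Constituents as truth assignments *)

Section Constituents.
Context {d : Order.disp_t} {T : ctbDistrLatticeType d} {R : realType}.
Implicit Types (c E G : T).

(** An arbitrary element may lie below neither [E] nor its complement, and the impossible event lies
    below both. Exactly one of the two is required here, so [c] assigns [E] a truth value. *)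
Definition decides c E : bool := (c <= ~` E)%O == ~~ (c <= E)%O.

Lemma decides_le_compl c E : decides c E -> (c <= ~` E)%O = ~~ (c <= E)%O.
Proof. by move/eqP. Qed.

Lemma decides_le_join c E G :
  decides c E -> (c <= E `|` G)%O = (c <= E)%O || (c <= G)%O.
Proof.
move=> dE; apply/idP/orP => [cEG|[cE|cG]]; last 2 first.
- exact: lexUl.
- exact: lexUr.
case cE: (c <= E)%O; [by left | right].
have: (c <= (E `|` G) `&` ~` E)%O by rewrite lexI cEG decides_le_compl ?cE.
by rewrite meetUl meetxC join0x => /le_trans; apply; rewrite leIl.
Qed.

(** The conjunction lies below the chosen literal by construction, and not below the opposite one
    because it is not impossible. *)
Lemma signed_conj_le n (E : n.-tuple T) (e : {ffun 'I_n -> bool}) i :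
  signed_conj E e != \bot%O ->
  (signed_conj E e <= tnth E i)%O = e i
  /\ decides (signed_conj E e) (tnth E i).
Proof.
move=> c0; set c := signed_conj E e in c0 *.
have c_le : (c <= if e i then tnth E i else ~` tnth E i)%O.
  exact: (@meets_inf _ _ _ i).
have nle2 : ~~ ((c <= tnth E i)%O && (c <= ~` tnth E i)%O).
  by rewrite -lexI meetxC lex0.
rewrite /decides; move: c_le nle2.
by case: (e i) => ->; rewrite ?andbT /= => /negbTE->.
Qed.

Lemma constituents4_decides (A B H K c : T) :
  c \in constituents [tuple A; B; H; K] ->
  [/\ decides c A, decides c B, decides c H & decides c K].
Proof.
case/mapP=> e; rewrite mem_filter => /andP[c0 _] ->.
by split; [have [_] := signed_conj_le 0 c0 | have [_] := signed_conj_le 1 c0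
         | have [_] := signed_conj_le 2 c0 | have [_] := signed_conj_le 3 c0].
Qed.

(** Logical independence enters here: every truth assignment to the four events is realized by a
    constituent. *)
Lemma constituents4_realize (A B H K : T) :
  logically_independent [tuple A; B; H; K] ->
  exists c : bool -> bool -> bool -> bool -> T, forall a b h k,
    c a b h k \in constituents [tuple A; B; H; K]
    /\ [/\ (c a b h k <= A)%O = a, (c a b h k <= B)%O = b,
           (c a b h k <= H)%O = h & (c a b h k <= K)%O = k].
Proof.
move=> indep.
pose e a b h k : {ffun 'I_4 -> bool} := [ffun i => tnth [tuple a; b; h; k] i].
exists (fun a b h k => signed_conj [tuple A; B; H; K] (e a b h k)) => a b h k.
have c0 := indep (e a b h k); split.
  by apply: map_f; rewrite mem_filter c0 mem_enum.
by split; [have [+ _] := signed_conj_le 0 c0 | have [+ _] := signed_conj_le 1 c0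
         | have [+ _] := signed_conj_le 2 c0 | have [+ _] := signed_conj_le 3 c0];
   rewrite ffunE.
Qed.

Lemma condE (A H c : T) (x : R) : decides c H ->
  cond A H x c = if (c <= H)%O then (c <= A)%O%:R else x.
Proof.
move=> dH; rewrite /cond /ind lexI decides_le_compl //.
by case: (c <= H)%O; rewrite ?andbT ?andbF ?mulr0 ?mulr1 ?addr0 ?add0r.
Qed.

Lemma cond_compl (A H c : T) (x : R) : decides c A -> decides c H ->
  cond (~` A)%O H (1 - x) c = 1 - cond A H x c.
Proof.
move=> dA dH; rewrite !condE // decides_le_compl //.
by case: (c <= H)%O => //; case: (c <= A)%O; rewrite /= ?subrr ?subr0.
Qed.

End Constituents.

(** * Necessary and sufficient conditions for the iterated conditional *)

Section IteratedConditional.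
Context {d : Order.disp_t} {T : ctbDistrLatticeType d} {R : realType}.
Variables (A B H K : T) (x y : R).
Hypothesis indep : logically_independent [tuple A; B; H; K].

Let cs := constituents [tuple A; B; H; K].

Let bool_natr : (true%:R = 1 :> R) * (false%:R = 0 :> R).
Proof. by []. Qed.

Let le_active m (F : m.-tuple (@bet d T R)) (S : {set 'I_m}) i (c : T) :
  i \in S -> (c <= active (tnth F i))%O ->
  (c <= \join_(j in S) active (tnth F j))%O.
Proof. by move=> iS /le_trans; apply; apply: joins_sup. Qed.

(** Single bets with stakes 1 and -1 suffice, since an indicator lies between 0 and 1. *)
Lemma coherent_xy_unit :
  coherent_xy A B H K x y -> (0 <= x <= 1) /\ (0 <= y <= 1).
Proof.
move=> coh; have [cst cstP] := constituents4_realize indep.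
have [cs0 [_ _ c0H c0K]] := cstP true true true true.
have bound (i : 'I_2) (t lb : R) :
    (forall c, c \in cs ->
       (c <= active (tnth [tuple bet_cond A H x; bet_cond B K y] i))%O ->
       lb <= t * gain (tnth [tuple bet_cond A H x; bet_cond B K y] i) c) ->
    lb <= 0.
  move=> lbP; apply: (coherent_gain_lb (S := [set i]) (s := fun=> t) coh _ cs0).
  - by apply/set0Pn; exists i; rewrite set11.
  - apply: (le_active (set11 i)).
    by case: i {lbP} => [[|[|]]] //= ?; rewrite (c0H, c0K).
  - by move=> c cs_c; rewrite !big_set1; apply: lbP.
have ind01 (E c : T) : 0 <= (ind E c : R) <= 1.
  by rewrite /ind ler0n lern1 leq_b1.
split; apply/andP; split.
- rewrite -oppr_le0; apply: (bound 0 1) => c _ /= cH.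
  have /andP[] := ind01 A c; rewrite [ind H c]/ind cH !mul1r; lra.
- rewrite -subr_le0; apply: (bound 0 (-1)) => c _ /= cH.
  have /andP[] := ind01 A c; rewrite [ind H c]/ind cH !mul1r; lra.
- rewrite -oppr_le0; apply: (bound 1 1) => c _ /= cK.
  have /andP[] := ind01 B c; rewrite [ind K c]/ind cK !mul1r; lra.
- rewrite -subr_le0; apply: (bound 1 (-1)) => c _ /= cK.
  have /andP[] := ind01 B c; rewrite [ind K c]/ind cK !mul1r; lra.
Qed.

(** Since the negation of [A|H] is [1 - A|H], the constant [mu] cancels. *)
Lemma bet_iter_gain (z mu : R) (c : T) : c \in cs ->
  gain (bet_iter A H B K x y z mu) c =
  conj_cond A H B K x y z c - mu * cond A H x c.
Proof.
case/constituents4_decides=> dA _ dH _.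
by rewrite /= /iter_cond cond_compl //; ring.
Qed.

Lemma coherent_conj_prevision (z mu : R) :
  coherent_xyzmu A B H K x y z mu -> z = mu * x.
Proof.
move=> coh; have [cst cstP] := constituents4_realize indep.
have [cs0 [_ _ c0H _]] := cstP true true true true.
have S0 : [set: 'I_4] != set0 by apply/set0Pn; exists 0; rewrite inE.
have act0 := le_active (F := [tuple bet_cond A H x; bet_cond B K y;
  bet_conj A H B K x y z; bet_iter A H B K x y z mu]) (in_setT 0) c0H.
have bound t : t * (mu * x - z) <= 0.
  (* The combination [t * (G_3 - G_4 - mu * G_1)] is constant. Taking [t] equal to 1 and -1 forces
     the constant to vanish. *)
  pose s (i : 'I_4) := nth 0 [:: - t * mu; 0; t; - t] i.
  apply: (coherent_gain_lb (s := s) coh S0 cs0 act0) => c cs_c _.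
  rewrite big_mkcond !big_ord_recl big_ord0 !inE.
  rewrite [gain (tnth _ (lift _ (lift _ (lift _ _)))) _]bet_iter_gain //.
  have [dA _ dH _] := constituents4_decides cs_c.
  rewrite /s /= condE //.
  by rewrite /ind; case: (c <= H)%O; rewrite !bool_natr; lra.
by have := bound 1; have := bound (-1); lra.
Qed.

(** These are the Fréchet-Hoeffding bounds: pointwise inequalities between [u], [v] and their
    minimum pass to the previsions. *)
Lemma coherent_conj_bounds (z mu : R) :
  0 <= x <= 1 -> 0 <= y <= 1 ->
  coherent_xyzmu A B H K x y z mu ->
  [/\ 0 <= z, x + y - 1 <= z, z <= x & z <= y].
Proof.
move=> x01 y01 coh; have [cst cstP] := constituents4_realize indep.
have [cs0 [_ _ c0H _]] := cstP true true true true.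
(* Omitting the iterated conditional confines the bets to [H] or [K], where the conjunction is a
   genuine minimum. *)
pose S : {set 'I_4} := ~: [set ord_max].
have S0 : 0 \in S by rewrite !inE.
have Sn0 : S != set0 by apply/set0Pn; exists 0.
have act0 := le_active (F := [tuple bet_cond A H x; bet_cond B K y;
  bet_conj A H B K x y z; bet_iter A H B K x y z mu]) S0 c0H.
have cond01 (E G c : T) (r : R) : decides c G -> 0 <= r <= 1 ->
    0 <= cond E G r c <= 1.
  by move=> dG r01; rewrite condE //; case: ifP => // _; rewrite ler0n lern1 leq_b1.
(* When a bet is called off, the conditional event equals its prevision, so the gain is value minus
   prevision in every case. *)
have gainE (E G c : T) (r : R) : decides c G ->
    ind G c * (ind E c - r) = cond E G r c - r.
  move=> dG; rewrite condE // /ind.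
  by case: (c <= G)%O; rewrite ?mul1r ?mul0r ?subrr.
have bound (s1 s2 s3 lb : R) :
    (forall u v, 0 <= u <= 1 -> 0 <= v <= 1 ->
       lb <= s1 * (u - x) + s2 * (v - y) + s3 * (Num.min u v - z)) ->
    lb <= 0.
  move=> lbP; pose s (i : 'I_4) := nth 0 [:: s1; s2; s3; 0] i.
  apply: (coherent_gain_lb (s := s) coh Sn0 cs0 act0) => c cs_c act_c.
  have [dA dB dH dK] := constituents4_decides cs_c.
  have cHK : (c <= H `|` K)%O.
    apply: le_trans act_c _; apply/joinsP => i.
    by case: i => [[|[|[|[|]]]] //= ?]; rewrite ?leUl ?leUr ?lexx // !inE.
  rewrite big_mkcond !big_ord_recl big_ord0 !inE.
  rewrite /s /= /conj_cond cHK !gainE // !addr0 addrA.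
  by apply: lbP; apply: cond01.
split.
- rewrite -oppr_le0; apply: (bound 0 0 1) => u v /andP[u0 u1] /andP[v0 v1].
  by rewrite minEle; case: ifP; lra.
- rewrite -subr_le0; apply: (bound (-1) (-1) 1) => u v /andP[u0 u1] /andP[v0 v1].
  by rewrite minEle; case: ifP; lra.
- rewrite -subr_le0; apply: (bound 1 0 (-1)) => u v _ _.
  have : Num.min u v <= u by rewrite ge_min lexx.
  by lra.
- rewrite -subr_le0; apply: (bound 0 1 (-1)) => u v _ _.
  have : Num.min u v <= v by rewrite ge_min lexx orbT.
  by lra.
Qed.

(** For [x = 0] the bet is active only on [AH]. There [A|H] is 1, and the gain is [B|K - mu] with
    [B|K] in the unit interval. *)
Lemma coherent_iter_unit (z mu : R) : x = 0 -> 0 <= y <= 1 ->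
  coherent_xyzmu A B H K x y z mu -> 0 <= mu <= 1.
Proof.
move=> x0 /andP[y0 y1] coh.
have [cst cstP] := constituents4_realize indep.
have [cs0 [c0A _ c0H _]] := cstP true true true true.
have S0 : [set ord_max : 'I_4] != set0 by apply/set0Pn; exists ord_max; rewrite inE.
have bound t lb :
    (forall b : R, 0 <= b <= 1 -> lb <= t * (b - mu)) -> lb <= 0.
  move=> lbP.
  apply: (coherent_gain_lb (s := fun=> t) coh S0 cs0).
    by rewrite big_set1 /= x0 eqxx lexI c0A c0H.
  move=> c cs_c; rewrite !big_set1 [gain (tnth _ _) _]bet_iter_gain //.
  have [dA dB dH dK] := constituents4_decides cs_c.
  rewrite /= x0 eqxx lexI => /andP[cA cH].
  rewrite /conj_cond decides_le_join // cH /= !condE // cA cH mulr1.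
  apply: lbP; rewrite le_min ge_min ler01 lexx /=.
  by case: ifP; rewrite ?y0 ?ler0n.
apply/andP; split.
- by rewrite -oppr_le0; apply: (bound 1) => b; lra.
- by rewrite -subr_le0; apply: (bound (-1)) => b; lra.
Qed.

(** The hypotheses make the four masses [p] below nonnegative, giving a joint distribution of [A]
    and [B] on [HK] with marginals [x] and [y]. *)
Lemma coherent_of_bounds (mu : R) :
  0 <= mu <= 1 -> x + y - 1 <= mu * x -> mu * x <= y -> 0 <= x ->
  coherent_xyzmu A B H K x y (mu * x) mu.
Proof.
move=> /andP[mu0 mu1] lo up x0; apply: coherent_of_null_mean => S Sn0.
have [cst cstP] := constituents4_realize indep.
have min_bool (a b : bool) : Num.min a%:R b%:R = (a && b)%:R :> R.
  by case: a; case: b; rewrite /= ?minxx ?(min_l ler01) ?(min_r ler01).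
have conjE a b : conj_cond A H B K x y (mu * x) (cst a b true true) = (a && b)%:R.
  have [/constituents4_decides[dA dB dH dK] [cA cB cH cK]] := cstP a b true true.
  by rewrite /conj_cond decides_le_join // !condE // cA cB cH cK min_bool.
have gain_iter a b :
    iter_cond A H B K x y (mu * x) mu (cst a b true true) - mu
    = (a && b)%:R - mu * a%:R.
  have [csc [cA cB cH cK]] := cstP a b true true.
  have [dA dB dH dK] := constituents4_decides csc.
  by have /= -> := bet_iter_gain (mu * x) mu csc; rewrite conjE condE // cH cA.
(* The bet on the iterated conditional alone is treated apart: its active event need not contain the
   constituents of [HK] where [A] fails. The masses [mu] and [1 - mu] stay inside [AH]; for [x > 0]
   they are the joint distribution conditioned on [A]. *)
have [S4|] := boolP (S == [set ord_max]).
  exists bool, (fun b => if b then mu else 1 - mu), (fun b => cst true b true true).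
  split.
  - by case; lra.
  - by rewrite big_bool /=; lra.
  - move=> b; have [csc [cA cB cH cK]] := cstP true b true true; split=> //.
    rewrite (eqP S4) big_set1 /=; case: ifP => _; first by rewrite lexI cA cH.
    by rewrite (le_trans _ (leUl _ _)) // lexI cA cH.
  - move=> j; rewrite (eqP S4) inE => /eqP->.
    by rewrite big_bool /= !gain_iter /= !bool_natr; lra.
rewrite eqEsubset sub1set negb_and => SN4.
(* Any other bet in [S] is active on all of [HK], which makes all four constituents available. *)
have [i iS i4] : exists2 i, i \in S & i != ord_max.
  have [/existsP[i /andP[]]|/existsPn no] := boolP [exists i, (i \in S) && (i != ord_max)].
    by exists i.
  have Ssub : S \subset [set ord_max].
    by apply/subsetP=> i iS; have := no i; rewrite iS negbK inE.
  move: SN4 Sn0; rewrite Ssub /= => S4 /set0Pn[i iS].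
  by have := subsetP Ssub i iS; rewrite inE => /eqP i4; rewrite -i4 iS in S4.
pose p a b := if a then if b then mu * x else x - mu * x
              else if b then y - mu * x else 1 - x - y + mu * x.
have sumE (f : bool -> bool -> R) : \sum_ab f ab.1 ab.2 =
    f true true + f true false + (f false true + f false false).
  by rewrite -(pair_bigA _ f) /= !big_bool.
exists (bool * bool)%type, (fun ab => p ab.1 ab.2),
  (fun ab => cst ab.1 ab.2 true true); split.
- by case=> [[] []] /=; nra.
- by rewrite sumE /=; lra.
- case=> a b; have [csc [cA cB cH cK]] := cstP a b true true; split=> //=.
  apply: (le_active iS).
  by case: i i4 {iS} => [[|[|[|[|]]]]] //= ? _; rewrite ?cH ?cK // lexUl ?cH.
- move=> j _.
  rewrite (sumE (fun a b => p a b * gain (tnth _ j) (cst a b true true))).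
  have gH a b := let: conj _ (And4 cA _ cH _) := cstP a b true true in (cA, cH).
  have gK a b := let: conj _ (And4 _ cB _ cK) := cstP a b true true in (cB, cK).
  case: j => [[|[|[|[|]]]]] //= ?.
  + by rewrite /ind !gH /= !bool_natr /p; ring.
  + by rewrite /ind !gK /= !bool_natr /p; ring.
  + by rewrite !conjE /= !bool_natr /p; ring.
  + by rewrite !gain_iter /= !bool_natr /p; ring.
Qed.

End IteratedConditional.

Theorem theorem4 (d : Order.disp_t) (T : ctbDistrLatticeType d) (R : realType)
    (A B H K : T) (x y : R) :
  logically_independent [tuple A; B; H; K] ->
  coherent_xy A B H K x y ->
  forall mu : R,
    coherent_extension A B H K x y mu <-> mu \in `[mu_low x y, mu_up x y].
Proof.
move=> indep /(coherent_xy_unit indep)[x01 y01] mu.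
have /andP[x0 x1] := x01; have /andP[y0 y1] := y01.
rewrite in_itv /= /mu_low /mu_up; case: ifPn => [xgt0|].
  (* Clearing the denominator [x] turns the fractional bounds on [mu] into bounds on [mu * x], the
     prevision of the conjunction. *)
  rewrite ge_max le_min ler_pdivrMr // ler_pdivlMr //.
  split=> [[z coh]|/andP[/andP[mu0 lo] /andP[mu1 up]]].
    have zE := coherent_conj_prevision indep coh.
    have [] := coherent_conj_bounds indep x01 y01 coh; rewrite zE => z0 -> zx ->.
    rewrite !andbT; apply/andP; split; first by rewrite -(pmulr_lge0 _ xgt0).
    by rewrite -(ler_pM2r xgt0 mu 1) mul1r.
  by exists (mu * x); apply: coherent_of_bounds => //; rewrite mu0.
rewrite -leNgt => xle0; have xE : x = 0 by apply/le_anti; rewrite xle0.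
split=> [[z coh]|mu01]; first exact: (coherent_iter_unit indep xE y01 coh).
(* At [x = 0] the bounds on the conjunction reduce to [y - 1 <= 0 <= y]. *)
by exists (mu * x); apply: coherent_of_bounds => //; rewrite xE mulr0; lra.
Qed.
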